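(* Let $n\ge 2$ and let $f:I\to\mathbb{R}^n$ be an $(n-1)$-regular parametrized curve with speed $\nu=\|f'\|$ and curvatures $\kappa_1,\dots,\kappa_{n-1}$. Then, for $2\le m\le n-2$, $$\kappa_m=\frac{\|f'\wedge f''\wedge\cdots\wedge f^{(m-1)}\|\;\|f'\wedge f''\wedge\cdots\wedge f^{(m+1)}\|}{\nu\,\|f'\wedge f''\wedge\cdots\wedge f^{(m)}\|^2},$$ and $$\kappa_{n-1}=\frac{\|f'\wedge f''\wedge\cdots\wedge f^{(n-2)}\|\;\big((f'\times f''\times\cdots\times f^{(n-1)})\cdot f^{(n)}\big)}{\nu\,\|f'\wedge f''\wedge\cdots\wedge f^{(n-1)}\|^2}.$$
   Context: Curves are smooth maps defined on an interval $I$. A curve $f$ is $k$-regular if $f'(t),\dots,f^{(k)}(t)$ are linearly independent for all $t\in I$. For an $(n-1)$-regular curve $f:I\to\mathbb{R}^n$, the Frenet apparatus $\{\kappa_1,\dots,\kappa_{n-1},V_1,\dots,V_n\}$ consists of a positively oriented orthonormal frame field $V_1,\dots,V_n$ along $f$ (the Frenet frame) and real functions $\kappa_1,\dots,\kappa_{n-1}$ on $I$ (the curvatures), with $\kappa_j>0$ for $j<n-1$, such that $V_1=f'/\nu$, $\mathrm{span}\{f',\dots,f^{(j)}\}=\mathrm{span}\{V_1,\dots,V_j\}$ for $1\le j\le n-1$, and the Frenet equations hold: $V_1'=\kappa_1\nu V_2$, $V_j'=-\kappa_{j-1}\nu V_{j-1}+\kappa_j\nu V_{j+1}$ for $2\le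 j\le n-1$, $V_n'=-\kappa_{n-1}\nu V_{n-1}$. The norm of a $p$-vector is $\|v_1\wedge\cdots\wedge v_p\|=\sqrt{\det(v_i\cdot v_j)}$; an empty wedge product (occurring only in the formula for $\kappa_{n-1}$ when $n=2$) has norm $1$. The cross product of $w_1,\dots,w_{n-1}\in\mathbb{R}^n$ is the vector $w_1\times\cdots\times w_{n-1}\in\mathbb{R}^n$ determined by $(w_1\times\cdots\times w_{n-1})\cdot X=\det(w_1,\dots,w_{n-1},X)$ for all $X\in\mathbb{R}^n$. *)

(* Defs.v *)
From HB Require Import structures.
From mathcomp Require Import all_boot all_order all_algebra.
From mathcomp Require Import all_classical all_reals all_analysis.

Set Implicit Arguments.
Unset Strict Implicit.
Unset Printing Implicit Defensive.

Import Order.TTheory GRing.Theory Num.Theory.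
Import numFieldNormedType.Exports.

Local Open Scope classical_set_scope.
Local Open Scope ring_scope.

(* The interval I may contain its endpoints, so derivatives are taken relative
   to I: the increment h only ranges over those h with t + h in I. This is the
   one-sided derivative at an endpoint and derive1 in the interior (derive_inE).
   Values of f outside I are never used at points of I. *)
Section DeriveIn.
Context {R : realType} {V : normedModType R}.
Implicit Types (I : set R) (f : R -> V) (t : R) (l : V).

Definition incr_in I t : set_system R := within [set h | I (h + t)] 0^'.

Definition diff_quot f t (h : R) : V := h^-1 *: (f (h + t) - f t).

Definition is_derive_in I f t l : Prop := diff_quot f t @ incr_in I t --> l.

Definition derivable_in I f t : Prop := cvg (diff_quot f t @ incr_in I t).

Definition derive_in I f t : V := lim (diff_quot f t @ incr_in I t).

Definition deriven_in I (k : nat) f : R -> V := iter k (derive_in I) f.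

Definition smooth_on I f : Prop :=
  forall (k : nat) t, I t -> derivable_in I (deriven_in I k f) t.

Lemma derive_inE I f t : interior I t -> derive_in I f t = derive1 f t.
Proof.
move=> It; rewrite /derive_in /derive1 /incr_in; congr (lim (_ @ _)).
apply/seteqP; split => A; rewrite /within /= /nbhs /=; last first.
  by apply: filterS => h Ah _.
move=> HA; have {}It : \forall h \near (0 : R)^', I (h + t).
  apply: nbhs_dnbhs; have : (fun h : R => h + t) @ (0 : R) --> t.
    by rewrite -[X in _ --> X]add0r; apply: cvgD; [exact: cvg_id|exact: cvg_cst].
  by apply.
by apply: filterS2 It HA => h Ih; apply.
Qed.

End DeriveIn.

Definition nondegenerate_interval {R : realType} (I : set R) : Prop :=
  is_interval I /\ exists a b : R, [/\ I a, I b & a < b].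

Section Euclidean.
Context {R : realType} {n : nat}.
Implicit Types u v X : 'rV[R]_n.

Definition dot u v : R := \sum_(i < n) u 0 i * v 0 i.

(* The library norm `|u| on 'rV[R]_n is the sup norm; the topology is the
   same. *)
Definition enorm u : R := Num.sqrt (dot u u).

Definition wedge_norm (p : nat) (v : 'I_p -> 'rV[R]_n) : R :=
  Num.sqrt (\det (\matrix_(i < p, j < p) dot (v i) (v j))).

(* The matrix with rows w_1, ..., w_(n-1), X. *)
Definition rows_with_last (w : 'I_n.-1 -> 'rV[R]_n) X : 'M[R]_n :=
  \matrix_(i < n) (if insub (val i) is Some j then w j else X).

(* The vector determined by dot (cross w) X = det(w_1, ..., w_(n-1), X) for
   all X (crossP, cross_unique), given by its coordinates. *)
Definition cross (w : 'I_n.-1 -> 'rV[R]_n) : 'rV[R]_n :=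
  \row_(k < n) \det (rows_with_last w (delta_mx 0 k)).

End Euclidean.

Lemma dot_delta {R : realType} (n : nat) (c : 'rV[R]_n) k :
  dot c (delta_mx 0 k) = c 0 k.
Proof.
rewrite /dot (bigD1 k) //= big1 ?addr0 ?mxE ?eqxx ?mulr1 // => i /negPf ik.
by rewrite mxE ik andbF mulr0.
Qed.

Lemma crossP {R : realType} (n : nat) (w : 'I_n.-1 -> 'rV[R]_n)
    (X : 'rV[R]_n) :
  (0 < n)%N -> dot (cross w) X = \det (rows_with_last w X).
Proof.
case: n w X => // n w X _.
have last0 (Y : 'rV[R]_n.+1) j : rows_with_last w Y ord_max j = Y 0 j.
  by rewrite mxE insubF //= ltnn.
rewrite (expand_det_row _ ord_max); apply: eq_bigr => k _.
rewrite last0 mulrC; congr (_ * _); rewrite mxE (expand_det_row _ ord_max).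
rewrite (bigD1 k) //= big1 ?addr0; last first.
  by move=> i /negPf ik; rewrite last0 mxE ik andbF mul0r.
rewrite last0 mxE !eqxx mul1r /cofactor; congr (_ * \det _).
apply/matrixP => i j; rewrite !mxE; case: insubP => //= /negP[].
have lt_in : (i < n)%N := ltn_ord i.
by rewrite /bump (leqNgt n i) lt_in.
Qed.

Lemma cross_unique {R : realType} (n : nat) (w : 'I_n.-1 -> 'rV[R]_n)
    (c : 'rV[R]_n) :
  (0 < n)%N -> (forall X, dot c X = \det (rows_with_last w X)) -> c = cross w.
Proof.
move=> n_gt0 Hc; apply/rowP => k.
by rewrite -!dot_delta Hc crossP.
Qed.

(* Frame vectors and curvatures are indexed from 1, as V_1, ..., V_n and
   kappa_1, ..., kappa_(n-1); values at other indices are irrelevant. *)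
Section Curves.
Context {R : realType} {n : nat}.
Implicit Types (I : set R) (f : R -> 'rV[R]_n) (t : R).

Definition regular_curve I (k : nat) f : Prop :=
  forall t, I t -> free [seq deriven_in I i f t | i <- iota 1 k].

Definition speed I f t : R := enorm (derive_in I f t).

Definition deriv_wedge_norm I f (p : nat) t : R :=
  wedge_norm (fun i : 'I_p => deriven_in I i.+1 f t).

Record frenet_apparatus I f (kappa : nat -> R -> R) (V : nat -> R -> 'rV[R]_n)
    : Prop := FrenetApparatus {
  frenet_orthonormal : forall t, I t -> forall i j : nat,
    (1 <= i <= n)%N -> (1 <= j <= n)%N -> dot (V i t) (V j t) = (i == j)%:R;
  frenet_oriented : forall t, I t -> 0 < \det (\matrix_(i < n) V i.+1 t);
  frenet_curvature_gt0 : forall t, I t -> forall j : nat,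
    (1 <= j < n.-1)%N -> 0 < kappa j t;
  frenet_tangent : forall t, I t ->
    V 1 t = (speed I f t)^-1 *: derive_in I f t;
  frenet_span : forall t, I t -> forall j : nat, (1 <= j <= n.-1)%N ->
    <<[seq deriven_in I i f t | i <- iota 1 j]>>%VS =
    <<[seq V i t | i <- iota 1 j]>>%VS;
  frenet_eq_first : forall t, I t ->
    is_derive_in I (V 1) t ((kappa 1 t * speed I f t) *: V 2 t);
  frenet_eq_middle : forall t, I t -> forall j : nat, (2 <= j <= n.-1)%N ->
    is_derive_in I (V j) t
      (- (kappa j.-1 t * speed I f t) *: V j.-1 t
       + (kappa j t * speed I f t) *: V j.+1 t);
  frenet_eq_last : forall t, I t ->
    is_derive_in I (V n) t
      (- (kappa n.-1 t * speed I f t) *: V n.-1 t)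
}.

End Curves.

(* Main.v *)
Require Import Defs.
From HB Require Import structures.
From mathcomp Require Import all_boot all_order all_algebra.
From mathcomp Require Import all_classical all_reals all_analysis.
From mathcomp Require Import ring.
Import Order.TTheory GRing.Theory Num.Theory.
Import numFieldNormedType.Exports.
Local Open Scope classical_set_scope.
Local Open Scope ring_scope.

(** Let a_k = f^(k) . V_k be the diagonal coefficients of the derivatives in
    the Frenet frame.  The span condition makes the derivatives triangular in
    the frame: f^(k) . V_j = 0 for k <= n-1 and j > k
    ([deriv_dot_frame0]).  Both sides of the two formulas are expressed through
    the a_k.

    - Norms and determinants.  A triangular family has a triangular coefficient
      matrix A, its Gram matrix is A A^T because the frame is orthonormal, and
      hence its wedge norm is the absolute value of the product of the diagonal
      coefficients ([wedge_norm_triangular]).  Likewise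
      (f' x ... x f^(n-1)) . f^(n) = det (f', ..., f^(n)) is det A times the
      determinant of the frame, which is 1 ([det_triangular]).  So the norm of
      f' ^ ... ^ f^(p) is a_1 ... a_p for p <= n-1, and the cross product term
      is a_1 ... a_n, without absolute value: this is where kappa_(n-1) gets
      its sign.

    - Recursion.  The function f^(k) . V_(k+1) vanishes on I.  Differentiating
      it and replacing V_(k+1)' by its Frenet equation leaves only the V_k term
      by triangularity, whence a_(k+1) = kappa_k nu a_k ([frenet_coefS]).  As
      a_1 = nu > 0 and kappa_j > 0 for j < n-1, all of a_1, ..., a_(n-1) are
      positive.

    Dividing, kappa_m = a_(m+1) / (nu a_m), and a quotient of consecutive
    partial products of the a_k gives both formulas at once ([curvatureE]). *)

(** * The dot product *)

Section DotProduct.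
Context {R : realType} {n : nat}.
Implicit Types u v w : 'rV[R]_n.

Lemma dotC u v : dot u v = dot v u.
Proof. by apply: eq_bigr => i _; rewrite mulrC. Qed.

Lemma dotDl u v w : dot (u + v) w = dot u w + dot v w.
Proof.
by rewrite /dot -big_split; apply: eq_bigr => i _; rewrite mxE mulrDl.
Qed.

Lemma dotZl (a : R) u w : dot (a *: u) w = a * dot u w.
Proof. by rewrite /dot mulr_sumr; apply: eq_bigr => i _; rewrite mxE mulrA. Qed.

Lemma dotDr u v w : dot u (v + w) = dot u v + dot u w.
Proof. by rewrite dotC dotDl !(dotC _ u). Qed.

Lemma dotZr (a : R) u w : dot u (a *: w) = a * dot u w.
Proof. by rewrite dotC dotZl dotC. Qed.

Lemma dot_sumr u (J : finType) (F : J -> 'rV[R]_n) :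
  dot u (\sum_j F j) = \sum_j dot u (F j).
Proof.
rewrite /dot exchange_big; apply: eq_bigr => i _.
by rewrite summxE mulr_sumr.
Qed.

Lemma mulmx_tr_dot (p q : nat) (A : 'M[R]_(p, n)) (B : 'M[R]_(q, n)) i j :
  (A *m B^T) i j = dot (row i A) (row j B).
Proof. by rewrite mxE; apply: eq_bigr => k _; rewrite !mxE. Qed.

Lemma enorm_gt0 u : u != 0 -> 0 < enorm u.
Proof.
move=> u0; rewrite sqrtr_gt0 lt_neqAle sumr_ge0 ?andbT; last first.
  by move=> i _; rewrite -expr2 sqr_ge0.
apply: contraNneq u0 => /esym/eqP.
rewrite psumr_eq0; last by move=> i _; rewrite -expr2 sqr_ge0.
move=> /allP u0; apply/eqP/rowP => i; rewrite mxE.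
by have := u0 i (mem_index_enum i); rewrite /= mulf_eq0 orbb => /eqP.
Qed.

Lemma dot_span0 (s : seq 'rV[R]_n) u w :
  (forall v, v \in s -> dot v w = 0) -> u \in span s -> dot u w = 0.
Proof.
move=> sw; rewrite -[s]in_tupleE => /coord_span ->; rewrite dotC dot_sumr.
apply: big1 => i _; rewrite dotZr dotC sw ?mulr0 //.
by apply: mem_nth; rewrite ltn_ord.
Qed.

End DotProduct.

(** * Derivatives relative to an interval *)

Section Derivation.
Set Implicit Arguments.
Unset Strict Implicit.
Context {R : realType} {I : set R}.

(** Limits of difference quotients are unique because the increments h with
    t + h in I accumulate at 0: as I is a nondegenerate interval, it contains a
    point c other than t, and then all points of the segment from t to c. *)
Lemma incr_in_proper t :
  nondegenerate_interval I -> I t -> ProperFilter (incr_in I t).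
Proof.
move=> [Iitv [a [b [Ia Ib ab]]]] It; rewrite /incr_in.
have [c Ic ct] : exists2 c, I c & c != t.
  by have [at_|] := eqVneq a t; [exists b => //; rewrite -at_ gt_eqF | exists a].
apply: Build_ProperFilter_ex => A.
rewrite /within /= => -[e /= e0 eA].
have d0 : 0 < `|c - t| by rewrite normr_gt0 subr_eq0.
(* The increment s (c - t) stays in the segment since s <= 1, and has absolute
   value at most e / 2. *)
pose s := Num.min 1 (e / 2 / `|c - t|).
have s0 : 0 < s by rewrite lt_min ltr01 !divr_gt0.
have s1 : s <= 1 by rewrite ge_min lexx.
exists (s * (c - t)); apply: eA => /=.
- rewrite sub0r normrN normrM gtr0_norm //.
  rewrite (@le_lt_trans _ _ (e / 2)) //; last first.
    by rewrite ltr_pdivrMr // ltr_pMr // ltr1n.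
  by rewrite -ler_pdivlMr // ge_min lexx orbT.
- by rewrite mulf_neq0 ?(gt_eqF s0) // subr_eq0.
- have [tc|ct'] := leP t c.
    apply: (Iitv t c) => //; apply/andP; split.
      by rewrite lerDr mulr_ge0 ?(ltW s0) // subr_ge0.
    by rewrite -lerBrDr ler_piMl // subr_ge0.
  apply: (Iitv c t) => //; apply/andP; split.
    rewrite -lerBlDr -[leLHS]mul1r.
    by rewrite ler_wnM2r // subr_le0 ltW.
  by rewrite gerDr mulr_ge0_le0 ?(ltW s0) // subr_le0 ltW.
Qed.

Lemma cvg_dot {n : nat} {F : set_system R} {FF : Filter F}
    (u v : R -> 'rV[R]_n) (a b : 'rV[R]_n) :
  u @ F --> a -> v @ F --> b -> dot (u x) (v x) @[x --> F] --> dot a b.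
Proof.
move=> ua vb; rewrite /dot.
apply: cvg_big => [|i _]; first exact: add_continuous.
apply: cvgM;
  apply: (continuous_cvg _ (h := fun M : 'rV[R]_n => M 0 i)) => //;
  exact: coord_continuous.
Qed.

(** The difference u(t + h) - u(t) is h times the difference quotient. *)
Lemma is_derive_in_cvg {n : nat} (t : R) (u : R -> 'rV[R]_n) (a : 'rV[R]_n) :
  is_derive_in I u t a -> u (h + t) @[h --> incr_in I t] --> u t.
Proof.
move=> ua.
have FF : Filter (incr_in I t) by apply: within_filter.
have h0 : (h : R) @[h --> incr_in I t] --> (0 : R).
  by apply: cvg_within_filter => A A0; apply: nbhs_dnbhs.
suff : u (h + t) @[h --> incr_in I t] --> 0 *: a + u t by rewrite scale0r add0r.
have : h *: diff_quot u t h + u t @[h --> incr_in I t] --> 0 *: a + u t.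
  by apply: cvgD; [exact: cvgZ | exact: cvg_cst].
apply: cvg_trans; apply: near_eq_cvg.
rewrite near_withinE; near=> h => _.
rewrite /diff_quot scalerA divff ?scale1r ?subrK //.
by near: h; exact: nbhs_dnbhs_neq.
Unshelve. all: by end_near.
Qed.

(** The Leibniz rule: the difference quotient of u . v is
    u'_h . v(t) + u(t + h) . v'_h with u'_h, v'_h those of u and v; the shifted
    factor u(t + h) converges by [is_derive_in_cvg]. *)
Lemma is_derive_in_dot {n : nat} (t : R) (u v : R -> 'rV[R]_n)
    (a b : 'rV[R]_n) :
  is_derive_in I u t a -> is_derive_in I v t b ->
  is_derive_in I (fun s => dot (u s) (v s)) t (dot a (v t) + dot (u t) b).
Proof.
move=> ua vb.
have FF : Filter (incr_in I t) by apply: within_filter.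
have : dot (diff_quot u t h) (v t) + dot (u (h + t)) (diff_quot v t h)
    @[h --> incr_in I t] --> dot a (v t) + dot (u t) b.
  apply: cvgD; apply: cvg_dot => //; first exact: cvg_cst.
  exact: is_derive_in_cvg ua.
apply: cvg_trans; apply: near_eq_cvg; apply: nearW => h.
rewrite /diff_quot dotZl dotZr -mulrDr; congr (_ * _).
rewrite -[- u t]scaleN1r -[- v t]scaleN1r dotDl dotDr dotZl dotZr.
by rewrite !mulN1r addrC addrA subrK.
Qed.

Lemma is_derive_in_const_on {V : normedModType R} (t : R) (g : R -> V)
    (c l : V) :
  nondegenerate_interval I -> I t ->
  (forall s, I s -> g s = c) -> is_derive_in I g t l -> l = 0.
Proof.
move=> hI It gc gl; have PF := incr_in_proper hI It.
apply: (@cvg_unique _ (@norm_hausdorff _ V) (diff_quot g t @ incr_in I t)) => //.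
apply: (@cvg_trans _ ((fun=> 0) @ incr_in I t)); last exact: cvg_cst.
apply: near_eq_cvg; rewrite near_withinE; apply: nearW => h Ih.
by rewrite /diff_quot !gc // subrr scaler0.
Qed.

End Derivation.

(** * Families that are triangular in an orthonormal frame *)

Section OrthonormalFrame.
Context {R : realType} {n : nat}.
Context (e : nat -> 'rV[R]_n).
Hypothesis e_orthonormal : forall i j : nat,
  (1 <= i <= n)%N -> (1 <= j <= n)%N -> dot (e i) (e j) = (i == j)%:R.

Let P : 'M[R]_n := \matrix_(i < n) e i.+1.

Let P_orthogonal : P *m P^T = 1%:M.
Proof.
apply/matrixP => i j.
by rewrite mulmx_tr_dot !rowK e_orthonormal ?ltn_ord // mxE eqSS.
Qed.

(** The matrix P with the frame as rows satisfies P P^T = 1, hence also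
    P^T P = 1, so u v^T = (u P^T) (v P^T)^T, and u P^T lists the coordinates
    of u. *)
Lemma parseval (u v : 'rV[R]_n) :
  dot u v = \sum_(j < n) dot u (e j.+1) * dot v (e j.+1).
Proof.
have coordE (w : 'rV[R]_n) j : (w *m P^T) 0 j = dot w (e j.+1).
  by rewrite mulmx_tr_dot row_id rowK.
transitivity ((u *m P^T *m (v *m P^T)^T) 0 0).
  rewrite trmx_mul trmxK mulmxA -(mulmxA u) (mulmx1C P_orthogonal) mulmx1.
  by rewrite mulmx_tr_dot !row_id.
by rewrite mxE; apply: eq_bigr => j _; rewrite !coordE mxE coordE.
Qed.

(** The Gram matrix of v_1, ..., v_p is A A^T, where A is the lower triangular
    p x p matrix of their first p coordinates: in the Parseval sum over all n
    coordinates, those of index above p vanish. *)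
Lemma wedge_norm_triangular (v : nat -> 'rV[R]_n) (p : nat) : (p <= n)%N ->
  (forall i j, (1 <= i <= p)%N -> (i < j <= n)%N -> dot (v i) (e j) = 0) ->
  wedge_norm (fun i : 'I_p => v i.+1)
  = `|\prod_(i < p) dot (v i.+1) (e i.+1)|.
Proof.
move=> pn v_tri.
pose A : 'M[R]_p := \matrix_(i < p, j < p) dot (v i.+1) (e j.+1).
have A_trig : is_trig_mx A.
  apply/is_trig_mxP => i j ij; rewrite mxE v_tri ?ltn_ord // ltnS ij.
  exact: leq_trans (ltn_ord j) pn.
have -> : \prod_(i < p) dot (v i.+1) (e i.+1) = \det A.
  by rewrite det_trig //; apply: eq_bigr => i _; rewrite mxE.
rewrite -sqrtr_sqr /wedge_norm expr2 -[X in _ * X]det_tr -det_mulmx.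
congr (Num.sqrt (\det _)); apply/matrixP => i j; rewrite !mxE parseval.
pose F k := dot (v i.+1) (e k.+1) * dot (v j.+1) (e k.+1).
transitivity (\sum_(k < p) F k); last first.
  by apply: eq_bigr => k _; rewrite !mxE.
rewrite (big_ord_widen _ F pn) [RHS]big_mkcond; apply: eq_bigr => k _.
case: ltnP => // pk; rewrite /F v_tri ?mul0r //; first by rewrite ltn_ord.
by rewrite ltnS (leq_trans (ltn_ord i) pk) ltn_ord.
Qed.

(** Multiplying the matrix of v_1, ..., v_n by P^T gives the triangular matrix
    of coordinates, and det P, being a positive square root of 1, equals 1. *)
Lemma det_triangular (v : nat -> 'rV[R]_n) :
  0 < \det (\matrix_(i < n) e i.+1) ->
  (forall i j, (1 <= i)%N -> (i < j <= n)%N -> dot (v i) (e j) = 0) ->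
  \det (\matrix_(i < n) v i.+1) = \prod_(i < n) dot (v i.+1) (e i.+1).
Proof.
move=> P_gt0 v_tri; rewrite -/P in P_gt0.
have detP : \det P = 1.
  have := congr1 determinant P_orthogonal.
  rewrite det_mulmx det_tr det1 -expr2 => /eqP.
  rewrite sqrf_eq1 => /orP[/eqP //|/eqP P1].
  by move: P_gt0; rewrite P1 ltr0N1.
have vP_trig : is_trig_mx ((\matrix_(i < n) v i.+1) *m P^T).
  apply/is_trig_mxP => i j ij; rewrite mulmx_tr_dot !rowK v_tri //.
  by rewrite ltnS ij ltn_ord.
transitivity (\det ((\matrix_(i < n) v i.+1) *m P^T)).
  by rewrite det_mulmx det_tr detP mulr1.
by rewrite det_trig //; apply: eq_bigr => i _; rewrite mulmx_tr_dot !rowK.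
Qed.

End OrthonormalFrame.

Lemma dot_cross {R : realType} {n : nat} (v : nat -> 'rV[R]_n) : (0 < n)%N ->
  dot (cross (fun i : 'I_n.-1 => v i.+1)) (v n)
  = \det (\matrix_(i < n) v i.+1).
Proof.
move=> n_gt0; rewrite crossP //; congr (\det _); apply/matrixP => i j.
rewrite !mxE; case: insubP => [k _ <- //|].
rewrite -leqNgt => ni; congr (v _ _ _).
by apply/eqP; rewrite eqn_leq ltn_ord andbT (leq_trans (leqSpred n)).
Qed.

(** * Derivatives of the curve in the Frenet frame *)

Section FrenetCoefficients.
Set Implicit Arguments.
Unset Strict Implicit.
Context {R : realType} {n : nat} {I : set R} {f : R -> 'rV[R]_n}.
Context {kappa : nat -> R -> R} {V : nat -> R -> 'rV[R]_n}.
Hypothesis hn : (2 <= n)%N.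
Hypothesis hI : nondegenerate_interval I.
Hypothesis hf : smooth_on I f.
Hypothesis hreg : regular_curve I n.-1 f.
Hypothesis hF : frenet_apparatus I f kappa V.

Local Notation D := (fun k t => deriven_in I k f t).

Definition frenet_coef (k : nat) (t : R) : R :=
  dot (deriven_in I k f t) (V k t).

Local Notation a := frenet_coef.

(** f^(k) lies in the span of V_1, ..., V_k, and these are orthogonal to V_j. *)
Lemma deriv_dot_frame0 t k j : I t -> (1 <= k <= n.-1)%N -> (k < j <= n)%N ->
  dot (D k t) (V j t) = 0.
Proof.
move=> It kn /andP[kj jn]; have /andP[k1 _] := kn.
have mem_iota1 i : (i \in iota 1 k) = (1 <= i <= k)%N.
  by rewrite mem_iota add1n ltnS.
apply: (@dot_span0 _ _ [seq V i t | i <- iota 1 k]).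
  move=> _ /mapP[i + ->]; rewrite mem_iota1 => /andP[i1 ik].
  have ij : (i < j)%N := leq_ltn_trans ik kj.
  rewrite (frenet_orthonormal hF It) ?(ltn_eqF ij) // ?i1.
    by rewrite (leq_trans (ltnW ij)).
  by rewrite (leq_trans i1 (ltnW ij)).
rewrite -(frenet_span hF It kn); apply: memv_span.
by apply/mapP; exists k => //; rewrite mem_iota1 k1 leqnn.
Qed.

Lemma speed_gt0 t : I t -> 0 < speed I f t.
Proof.
move=> It; apply: enorm_gt0; apply: (free_not0 (hreg It)).
by apply/mapP; exists 1%N => //; rewrite mem_iota /= add1n prednK // ltnW.
Qed.

Lemma frenet_coef1 t : I t -> a 1 t = speed I f t.
Proof.
move=> It; have nu0 := speed_gt0 It.
rewrite /frenet_coef (frenet_tangent hF It) dotZr.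
rewrite -[dot _ _]sqr_sqrtr; last first.
  by apply: sumr_ge0 => i _; rewrite -expr2 sqr_ge0.
by rewrite expr2 mulKf ?gt_eqF.
Qed.

(** Differentiating f^(k) . V_(k+1) = 0 gives
    a_(k+1) = - f^(k) . V_(k+1)'.  For k + 1 < n the Frenet equation for
    V_(k+1)' has an additional V_(k+2) term, which is orthogonal to f^(k); for
    k + 1 = n there is none. *)
Lemma frenet_coefS t k : I t -> (1 <= k <= n.-1)%N ->
  a k.+1 t = kappa k t * speed I f t * a k t.
Proof.
move=> It kn; have /andP[k1 kn1] := kn.
have Sk_le : (k.+1 <= n)%N by rewrite -(prednK (ltnW hn)) ltnS.
have Dk : is_derive_in I (D k) t (D k.+1 t) by exact: hf.
suff [b dVb Vk0] : exists2 b, is_derive_in I (V k.+1) t b &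
    dot (D k t) b = - (kappa k t * speed I f t) * a k t.
  have Dk0 s : I s -> dot (D k s) (V k.+1 s) = 0.
    by move=> Is; rewrite deriv_dot_frame0 // ltnSn.
  have /eqP := is_derive_in_const_on hI It Dk0 (is_derive_in_dot Dk dVb).
  by rewrite Vk0 mulNr subr_eq0 => /eqP.
have [kn2|nk] := ltnP k n.-1.
  exists (- (kappa k t * speed I f t) *: V k t
          + (kappa k.+1 t * speed I f t) *: V k.+2 t).
    by apply: (frenet_eq_middle hF It (j := k.+1)); rewrite ltnS k1.
  rewrite dotDr !dotZr [dot _ (V k.+2 t)]deriv_dot_frame0 ?mulr0 ?addr0 //.
  by rewrite ltnS leqnSn -(prednK (ltnW hn)) ltnS.
have kE : k = n.-1 by apply/eqP; rewrite eqn_leq kn1 nk.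
exists (- (kappa k t * speed I f t) *: V k t); last by rewrite dotZr.
by rewrite kE prednK ?(ltnW hn) //; exact: (frenet_eq_last hF It).
Qed.

Lemma frenet_coef_gt0 t k : I t -> (1 <= k <= n.-1)%N -> 0 < a k t.
Proof.
move=> It; elim: k => // -[|k] IHk kn; first by rewrite frenet_coef1 ?speed_gt0.
have kn1 : (1 <= k.+1 <= n.-1)%N by rewrite (ltnW kn).
rewrite frenet_coefS // !mulr_gt0 ?speed_gt0 ?IHk //.
exact: (frenet_curvature_gt0 hF It).
Qed.

Lemma deriv_wedge_normE t p : I t -> (p <= n.-1)%N ->
  deriv_wedge_norm I f p t = \prod_(i < p) a i.+1 t.
Proof.
move=> It pn.
rewrite /deriv_wedge_norm.
rewrite (@wedge_norm_triangular _ _ (V ^~ t) _ (D ^~ t)).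
- rewrite gtr0_norm // prodr_gt0 // => i _.
  by rewrite frenet_coef_gt0 // (leq_trans (ltn_ord i) pn).
- exact: (frenet_orthonormal hF It).
- exact: leq_trans pn (leq_pred n).
move=> i j /andP[i1 ip] ij; rewrite deriv_dot_frame0 // i1.
exact: leq_trans ip pn.
Qed.

Lemma dot_cross_derivE t : I t ->
  dot (cross (fun i : 'I_n.-1 => D i.+1 t)) (D n t) = \prod_(i < n) a i.+1 t.
Proof.
move=> It; rewrite (dot_cross (D ^~ t)) ?(ltnW hn) //.
apply: (@det_triangular _ _ (V ^~ t) _ (D ^~ t)).
- exact: (frenet_orthonormal hF It).
- exact: (frenet_oriented hF It).
move=> i j i1 /andP[ij jn]; rewrite deriv_dot_frame0 // ?i1 ?ij //=.
by rewrite -ltnS (prednK (ltnW hn)) (leq_trans ij).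
Qed.

Lemma deriv_wedge_norm_gt0 t p : I t -> (p <= n.-1)%N ->
  0 < deriv_wedge_norm I f p t.
Proof.
move=> It pn; rewrite deriv_wedge_normE // prodr_gt0 // => i _.
by rewrite frenet_coef_gt0 // (leq_trans (ltn_ord i) pn).
Qed.

(** The common form of the two formulas: the product of a_1, ..., a_(m+1) is a
    wedge norm when m + 1 < n, and the signed determinant when m = n - 1. *)
Lemma curvatureE t m : I t -> (1 <= m <= n.-1)%N ->
  kappa m t = deriv_wedge_norm I f m.-1 t * \prod_(i < m.+1) a i.+1 t
              / (speed I f t * deriv_wedge_norm I f m t ^+ 2).
Proof.
move=> It mn; case: m mn => // m mn; have /= mn1 := mn.
have Wm_neq0 : deriv_wedge_norm I f m t != 0.
  by rewrite gt_eqF // deriv_wedge_norm_gt0 // ltnW.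
have am_neq0 : a m.+1 t != 0 by rewrite gt_eqF // frenet_coef_gt0.
have nu_neq0 : speed I f t != 0 by rewrite gt_eqF // speed_gt0.
have WS : deriv_wedge_norm I f m.+1 t = deriv_wedge_norm I f m t * a m.+1 t.
  by rewrite !deriv_wedge_normE ?big_ord_recr // ltnW.
rewrite big_ord_recr /= -deriv_wedge_normE // WS (frenet_coefS It mn).
by field; rewrite Wm_neq0 am_neq0 nu_neq0.
Qed.

End FrenetCoefficients.

Theorem corollary3p4 (R : realType) (n : nat) (hn : (2 <= n)%N)
    (I : set R) (hI : nondegenerate_interval I)
    (f : R -> 'rV[R]_n) (hf : smooth_on I f)
    (hreg : regular_curve I n.-1 f)
    (kappa : nat -> R -> R) (V : nat -> R -> 'rV[R]_n)
    (hF : frenet_apparatus I f kappa V) :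
  (forall m : nat, (2 <= m <= n - 2)%N -> forall t : R, I t ->
     kappa m t =
       deriv_wedge_norm I f m.-1 t * deriv_wedge_norm I f m.+1 t
       / (speed I f t * deriv_wedge_norm I f m t ^+ 2)) /\
  (forall t : R, I t ->
     kappa n.-1 t =
       deriv_wedge_norm I f (n - 2) t
       * dot (cross (fun i : 'I_n.-1 => deriven_in I i.+1 f t))
             (deriven_in I n f t)
       / (speed I f t * deriv_wedge_norm I f n.-1 t ^+ 2)).
Proof.
have n_gt0 : (0 < n)%N := ltnW hn.
have n1_gt0 : (0 < n.-1)%N by rewrite -ltnS prednK.
rewrite subn2; split=> [m /andP[m2 mn] t It|t It].
  have mn1 : (m.+1 <= n.-1)%N by rewrite -[n.-1]prednK // ltnS.
  rewrite (curvatureE hn hI hf hreg hF It) ?(ltnW m2) ?(ltnW mn1) //.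
  by rewrite -(deriv_wedge_normE hn hI hf hreg hF It mn1).
rewrite (dot_cross_derivE hn hF It).
rewrite (curvatureE hn hI hf hreg hF It) ?n1_gt0 ?leqnn //.
by rewrite prednK.
Qed.
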